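(* Let $r\ge 3$ be an odd integer, let $s\ge 1$ be an integer, and let $G$ be isomorphic to the group $M_{2rs}=\langle a,b : a^r=b^{2s}=1,\ bab^{-1}=a^{-1}\rangle$ of order $2rs$. Then the signless Laplacian spectrum of the non-commuting graph $\Gamma_G$ is $$\left\{(2s(r-1))^{r(s-1)},\ (rs)^{(r-1)s-1},\ ((2r-3)s)^{r-1},\ \left(\tfrac{s\left(4r-3+\sqrt{8r^2-16r+9}\right)}{2}\right)^1,\ \left(\tfrac{s\left(4r-3-\sqrt{8r^2-16r+9}\right)}{2}\right)^1\right\}$$ and its signless Laplacian energy is $$LE^+(\Gamma_G)=\begin{cases}\frac{3s(4s-1)}{5}+s\sqrt{33}, & \text{if } r=3,\\[2pt] s\left(\frac{2r(r-1)(r-2)s}{2r-1}-(2r-3)+\sqrt{8r^2-16r+9}\right), & \text{if } r\ge 5.\end{cases}$$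
   Context: For a finite non-abelian group $G$ with center $Z(G)$, the non-commuting graph $\Gamma_G$ is the simple undirected graph with vertex set $G\setminus Z(G)$ in which $x,y$ are adjacent iff $xy\ne yx$. For a finite simple graph $\mathcal G$ with vertex set $v(\mathcal G)$, edge set $e(\mathcal G)$, adjacency matrix $A(\mathcal G)$ and diagonal degree matrix $D(\mathcal G)$, the signless Laplacian matrix is $Q(\mathcal G)=D(\mathcal G)+A(\mathcal G)$, and its signless Laplacian spectrum is the multiset of eigenvalues of $Q(\mathcal G)$. The notation $\{(\gamma_1)^{d_1},\dots,(\gamma_l)^{d_l}\}$ means the multiset in which $\gamma_r$ is listed $d_r$ times (entries with $d_r=0$ are absent; coinciding listed values have their multiplicities added). The signless Laplacian energy is $LE^+(\mathcal G)=\sum_{\gamma}\left|\gamma-\frac{2|e(\mathcal G)|}{|v(\mathcal G)|}\right|$, the sum being over the signless Laplacian spectrum with multiplicity. *)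

(* Defs.v *)
From mathcomp Require Import all_boot all_order all_fingroup all_algebra all_solvable.
Set Implicit Arguments.
Unset Strict Implicit.
Unset Printing Implicit Defensive.
Import GRing.Theory Num.Theory.
Local Open Scope ring_scope.

Record sgraph := SGraph {
  vertex : finType;
  adj : rel vertex;
  adj_sym : symmetric adj;
  adj_irrefl : irreflexive adj
}.

Definition edges (X : sgraph) : {set {set vertex X}} :=
  [set E | [exists x, [exists y, adj x y && (E == [set x; y])]]].

Definition degree (X : sgraph) (x : vertex X) : nat :=
  #|[set y | adj x y]|.

Section Spectrum.

Variable C : numClosedFieldType.

Definition adjacency_mx (X : sgraph) : 'M[C]_#|vertex X| :=
  \matrix_(i, j) (adj (enum_val i) (enum_val j))%:R.

Definition degree_mx (X : sgraph) : 'M[C]_#|vertex X| :=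
  diag_mx (\row_i (degree (enum_val i))%:R).

Definition signless_laplacian (X : sgraph) : 'M[C]_#|vertex X| :=
  degree_mx X + adjacency_mx X.

(* Eigenvalues listed with algebraic multiplicity; the order of the list is
   irrelevant, so spectra are to be compared with perm_eq. *)
Definition spectrum (n : nat) (A : 'M[C]_n) : seq C :=
  sval (closed_field_poly_normal (char_poly A)).

Lemma char_poly_spectrum (n : nat) (A : 'M[C]_n) :
  char_poly A = \prod_(z <- spectrum A) ('X - z%:P).
Proof.
rewrite /spectrum; case: closed_field_poly_normal => /= t.
by rewrite (monicP (char_poly_monic A)) scale1r.
Qed.

Lemma mem_spectrum (n : nat) (A : 'M[C]_n) (z : C) :
  (z \in spectrum A) = eigenvalue A z.
Proof. by rewrite eigenvalue_root_char char_poly_spectrum root_prod_XsubC. Qed.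

Definition signless_laplacian_spectrum (X : sgraph) : seq C :=
  spectrum (signless_laplacian X).

Definition signless_laplacian_energy (X : sgraph) : C :=
  \sum_(z <- signless_laplacian_spectrum X)
     `|z - (2 * #|edges X|)%:R / #|vertex X|%:R|.

End Spectrum.

Section NonCommutingGraph.

Variables (gT : finGroupType) (G : {group gT}).

Definition nc_vertex : finType := {x : gT | x \in G :\: 'Z(G)%g}.

Definition nc_adj : rel nc_vertex :=
  fun x y => (val x * val y != val y * val x)%g.

Lemma nc_adj_sym : symmetric nc_adj.
Proof. by move=> x y; rewrite /nc_adj eq_sym. Qed.

Lemma nc_adj_irrefl : irreflexive nc_adj.
Proof. by move=> x; rewrite /nc_adj eqxx. Qed.

Definition noncommuting_graph : sgraph := SGraph nc_adj_sym nc_adj_irrefl.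

End NonCommutingGraph.

(* Main.v *)
Require Import Defs.
From mathcomp Require Import all_boot all_order all_fingroup all_algebra all_solvable.
From mathcomp Require Import ring zify.
Set Implicit Arguments.
Unset Strict Implicit.
Unset Printing Implicit Defensive.
Import Order.TTheory GRing.Theory Num.Theory.
Local Open Scope ring_scope.

(* Every element of G is uniquely a^i b^(2k) b^e with i < r, k < s, e < 2, and
   b^2 is central.  Hence commuting is an equivalence relation on G \ Z(G):
   one class consists of the (r-1)s noncentral elements with e = 0, and there
   are r classes of size s, one for each i, with e = 1.  So the non-commuting
   graph is complete multipartite.  If such a graph has N vertices and parts of
   sizes n_i, indexed by the columns of the incidence matrix B, then
   z - Q = diag(z - N + n_i) + B (1 - J) B^T, so Sylvester's identity and the
   rank-one determinant formula give
     char_poly Q (z) = prod_i (z-N+n_i)^(n_i - 1) (z-N+2n_i)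
                       * (1 - sum_i n_i / (z-N+2n_i)). *)

(** * Determinant and polynomial identities *)

Lemma det_add1_mulmxC (R : comNzRingType) (m n : nat)
    (A : 'M[R]_(m, n)) (B : 'M[R]_(n, m)) :
  \det (1%:M + A *m B) = \det (1%:M + B *m A).
Proof.
(* Multiplying [M] by the same unipotent block matrix on the right or on the left makes it block
   triangular, so [\det M] equals both sides. *)
pose M := block_mx 1%:M (- A) B 1%:M : 'M[R]_(m + n).
have eL : M *m block_mx 1%:M A 0 1%:M = block_mx 1%:M 0 B (1%:M + B *m A).
  by rewrite mulmx_block !mul1mx !mulmx1 !mulmx0 !addr0 addrN addrC.
have eR : block_mx 1%:M A 0 1%:M *m M = block_mx (1%:M + A *m B) 0 B 1%:M.
  by rewrite mulmx_block !mul1mx !mulmx1 !mul0mx !add0r addNr.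
have := congr1 determinant eL; have := congr1 determinant eR.
rewrite !det_mulmx det_lblock det_ublock det_lblock !det1 !mulr1 !mul1r.
by move=> <- <-.
Qed.

Lemma horner_char_poly (R : comNzRingType) (n : nat) (A : 'M[R]_n) (z : R) :
  (char_poly A).[z] = \det (z%:M - A).
Proof.
rewrite -[LHS]/(horner_eval z (char_poly A)) /char_poly -det_map_mx.
congr (\det _); apply/matrixP=> i j; rewrite !mxE /= /horner_eval.
by rewrite hornerD hornerN hornerMn hornerX hornerC.
Qed.

(** Otherwise [p - q] would have as many distinct roots among the naturals above [N] as its size,
    which exceeds its degree. *)
Lemma poly_eq_large_nat (R : numDomainType) (p q : {poly R}) (N : nat) :
  (forall m : nat, (N < m)%N -> p.[m%:R] = q.[m%:R]) -> p = q.
Proof.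
move=> pq; apply/eqP; rewrite -subr_eq0; apply/negPn/negP => nz.
pose rs : seq R := [seq m%:R | m <- iota N.+1 (size (p - q))].
have uniq_rs : uniq rs.
  by rewrite map_inj_uniq ?iota_uniq // => i j /eqP; rewrite eqr_nat => /eqP.
suff /(max_poly_roots nz)/(_ uniq_rs) : all (root (p - q)) rs.
  by rewrite size_map size_iota ltnn.
apply/allP=> _ /mapP[m + ->]; rewrite mem_iota => /andP[lt_m _].
by rewrite /root hornerD hornerN pq // subrr.
Qed.

Lemma det_diag_rank1 (F : fieldType) (n : nat) (d u v : 'I_n -> F) :
  (forall i, d i != 0) ->
  \det (diag_mx (\row_i d i) - \matrix_(i, j) (u i * v j))
  = (\prod_i d i) * (1 - \sum_i u i * v i / d i).
Proof.
move=> d0.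
pose U : 'cV[F]_n := \col_i (- u i / d i); pose V : 'rV[F]_n := \row_j v j.
have -> : diag_mx (\row_i d i) - \matrix_(i, j) (u i * v j)
          = diag_mx (\row_i d i) *m (1%:M + U *m V).
  rewrite mulmxDr mulmx1; congr (_ + _); apply/matrixP=> i j.
  rewrite mul_diag_mx !mxE big_ord1 !mxE; have di := d0 i; field; exact: di.
rewrite det_mulmx det_diag det_add1_mulmxC.
rewrite [X in \det (_ + X)]mx11_scalar -raddfD /= det_scalar1 !mxE -sumrN.
congr (_ * (_ + _)); first by apply: eq_bigr => i _; rewrite mxE.
by apply: eq_bigr => i _; rewrite !mxE mulrAC mulNr !mulrN mulrC [u i * _]mulrC.
Qed.

(** * Characteristic polynomial for a complete multipartite graph *)

Section CompleteMultipartite.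
Variables (C : numClosedFieldType) (X : sgraph) (k : nat) (c : vertex X -> 'I_k).
Hypothesis adjE : forall x y, adj x y = (c x != c y).

Let N := #|vertex X|.
Let n i := #|[set x | c x == i]|.

Lemma degree_multipartite x : (degree x + n (c x))%N = N.
Proof.
rewrite addnC /N -(cardsC [set y | c y == c x]); congr (_ + _)%N.
by apply: eq_card => y; rewrite !inE adjE eq_sym.
Qed.

(** Dividing by [z - N + n_i], rather than using the truncated exponent [n i - 1], keeps the formula
    valid for empty parts, whose factor is then 1. *)
Lemma signless_char_poly_multipartite (z : C) :
  (forall i, z - N%:R + (n i)%:R != 0) ->
  (forall i, z - N%:R + (2 * n i)%:R != 0) ->
  (char_poly (signless_laplacian C X)).[z]
  = (\prod_i ((z - N%:R + (n i)%:R) ^+ n i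
              * (z - N%:R + (2 * n i)%:R) / (z - N%:R + (n i)%:R)))
    * (1 - \sum_i (n i)%:R / (z - N%:R + (2 * n i)%:R)).
Proof.
move=> t0 t20; rewrite horner_char_poly.
pose t i := z - N%:R + (n i)%:R; pose w i := (n i)%:R / t i.
pose e (x : 'I_#|vertex X|) := c (enum_val x).
have tE x : z - (degree x)%:R = t (c x).
  by rewrite /t -(degree_multipartite x) natrD; ring.
have cardE F : \sum_(x : 'I_#|vertex X|) F (e x) = \sum_i (n i)%:R * F i :> C.
  rewrite (reindex enum_rank) /=; last by apply: onW_bij; apply: enum_rank_bij.
  rewrite (partition_big c xpredT) //=; apply: eq_bigr => i _.
  rewrite (eq_bigr (fun=> F i)); last first.
    by move=> x /eqP cx; rewrite /e enum_rankK cx.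
  by rewrite sumr_const mulr_natl /n cardsE.
have prodE F : \prod_(x : 'I_#|vertex X|) F (e x) = \prod_i F i ^+ n i :> C.
  rewrite (reindex enum_rank) /=; last by apply: onW_bij; apply: enum_rank_bij.
  rewrite (partition_big c xpredT) //=; apply: eq_bigr => i _.
  rewrite (eq_bigr (fun=> F i)); last first.
    by move=> x /eqP cx; rewrite /e enum_rankK cx.
  by rewrite prodr_const /n cardsE.
(* With B the incidence matrix of the parts and D the diagonal of the [t (e x)], [A] is D^-1 B and
   [M] is (1 - J) B^T. *)
pose A : 'M[C]_(#|vertex X|, k) := \matrix_(x, j) ((e x == j)%:R / t (e x)).
pose M : 'M[C]_(k, #|vertex X|) := \matrix_(i, y) ((i == e y)%:R - 1).
have -> : z%:M - signless_laplacian C X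
          = diag_mx (\row_x t (e x)) *m (1%:M + A *m M).
  apply/matrixP=> x y; rewrite mul_diag_mx !mxE -/(e x).
  rewrite (bigD1 (e x)) //= big1 => [|j ne_j]; last first.
    by rewrite !mxE eq_sym (negbTE ne_j) !mul0r.
  rewrite !mxE eqxx addr0 adjE -/(e x) -/(e y) -tE.
  have := t0 (e x); rewrite -/(t _) -tE.
  case: (x =P y) => [<-|_]; rewrite ?eqxx ?mulr1n ?mulr0n; last case: (e x == e y);
    by rewrite /= => nz; field; exact: nz.
rewrite det_mulmx det_diag det_add1_mulmxC.
have -> : 1%:M + M *m A = diag_mx (\row_i (1 + w i)) - \matrix_(i, j) (1 * w j).
  apply/matrixP=> i j; rewrite !mxE.
  under eq_bigr => y _ do rewrite !mxE.
  rewrite (cardE (fun l => ((i == l)%:R - 1) * ((l == j)%:R / t l))).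
  rewrite (bigD1 j) //= big1 => [|l ne_l]; last first.
    by rewrite (negbTE ne_l) mul0r !mulr0.
  rewrite eqxx addr0 /w; have := t0 j; rewrite -/(t _).
  by case: (i =P j) => [->|_] nz; rewrite ?mulr1n ?mulr0n; field; exact: nz.
have wE l : 1 + w l = (z - N%:R + (2 * n l)%:R) / t l.
  have := t0 l; rewrite /w /t natrM => nz; field; exact: nz.
rewrite det_diag_rank1; last by move=> i; rewrite wE mulf_neq0 ?invr_eq0 ?t0 ?t20.
rewrite mulrA; congr (_ * (1 - _)).
  under eq_bigr do rewrite mxE.
  rewrite prodE -big_split /=; apply: eq_bigr => i _.
  by rewrite wE mulrA.
apply: eq_bigr => i _; rewrite wE /w mul1r.
have := t0 i; have := t20 i; rewrite -/(t i) natrM => n2 n1; field.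
by rewrite n2.
Qed.

End CompleteMultipartite.

(** * Handshake identity *)

Lemma sum_degree (X : sgraph) : (\sum_(x : vertex X) degree x = 2 * #|edges X|)%N.
Proof.
have -> : (\sum_(x : vertex X) degree x = \sum_(p | @adj X p.1 p.2) 1)%N.
  rewrite -(pair_big_dep xpredT (@adj X) (fun _ _ => 1%N)) /=.
  by apply: eq_bigr => x _; rewrite sum1_card /degree cardsE.
(* Ordered adjacent pairs are grouped by their underlying edge; each fibre is a pair and its swap,
   distinct by irreflexivity. *)
rewrite (partition_big (fun p => [set p.1; p.2]) (mem (edges X))) /=; last first.
  move=> [x y] /= xy; rewrite inE; apply/existsP; exists x.
  by apply/existsP; exists y; rewrite xy eqxx.
rewrite mulnC -sum_nat_const; apply: eq_bigr => E.
rewrite inE => /existsP[x /existsP[y /andP[xy /eqP ->]]].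
have ne_xy : x != y by apply: contraTneq xy => ->; rewrite adj_irrefl.
rewrite sum1dep_card -[RHS](_ : #|[set (x, y); (y, x)]| = _); last first.
  by rewrite cards2 xpair_eqE (negbTE ne_xy).
apply: eq_card => -[u v]; rewrite !inE /= !xpair_eqE.
apply/andP/orP => [[uv /eqP E2]|].
  have := set21 u v; have := set22 u v; rewrite E2 !inE.
  have ne_uv : u != v by apply: contraTneq uv => ->; rewrite adj_irrefl.
  move=> /orP[] /eqP ev /orP[] /eqP eu; rewrite ev eu !eqxx ?orbT //.
  - by rewrite eu ev eqxx in ne_uv.
  - by right.
  - by left.
  - by rewrite eu ev eqxx in ne_uv.
case=> /andP[/eqP-> /eqP->]; first by rewrite xy.
by rewrite adj_sym xy setUC.
Qed.

(** Clearing the two poles of the rank-one factor leaves the quadratic whose roots are the two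
    irrational eigenvalues. [A], [U], [V] stand for the powers of the other linear factors. *)
Lemma quadratic_factor (F : fieldType) (A U V z r s : F) :
  z - s != 0 -> z - (2 * r - 3) * s != 0 ->
  A * (z - s) * (U * ((z - (2 * r - 3) * s) * V))
    * (1 - ((r - 1) * s / (z - s) + r * (s / (z - (2 * r - 3) * s))))
  = U * (A * (V * (z ^+ 2 - (4 * r - 3) * s * z + 2 * r * (r - 1) * s ^+ 2))).
Proof. by move=> b0 v0; field; rewrite b0 v0. Qed.

(** * Spectrum and energy for the given part sizes, with [r.+2] and [s.+1] as the r and s of the
    theorem *)

Section MultipartiteSpectrum.
Variables (C : numClosedFieldType) (X : sgraph) (r s : nat).
Variable c : vertex X -> 'I_r.+3.
Hypothesis adjE : forall x y, adj x y = (c x != c y).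
Hypothesis card0 : #|[set x | c x == ord0]| = (r.+1 * s.+1)%N.
Hypothesis cardS : forall i, #|[set x | c x == lift ord0 i]| = s.+1.

Lemma card_vertex_parts : #|vertex X| = ((r.+1 + r.+2) * s.+1)%N.
Proof.
rewrite -sum1_card (partition_big c xpredT) //= big_ord_recl /=.
rewrite sum1dep_card card0 (eq_bigr (fun=> s.+1)) => [|i _]; last first.
  by rewrite sum1dep_card cardS.
by rewrite sum_nat_const card_ord mulnDl.
Qed.

(** Degrees are summed part by part: [r.+2 * s.+1] on the large part, [2 * r.+1 * s.+1] on the small
    ones. *)
Lemma double_card_edges_parts : (2 * #|edges X| = 3 * r.+1 * r.+2 * s.+1 ^ 2)%N.
Proof.
have dE := degree_multipartite adjE; have N := card_vertex_parts.
rewrite -sum_degree (partition_big c xpredT) //= big_ord_recl /=.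
rewrite (eq_bigr (fun=> (r.+2 * s.+1)%N)) => [|x /eqP cx]; last first.
  by have := dE x; rewrite cx card0 N; lia.
rewrite sum_nat_const -[X in (X * _ + _)%N]cardsE card0.
rewrite (eq_bigr (fun=> (s.+1 * (2 * r.+1 * s.+1))%N)) => [|i _]; last first.
  rewrite (eq_bigr (fun=> (2 * r.+1 * s.+1)%N)) => [|x /eqP cx]; last first.
    by have := dE x; rewrite cx cardS N; lia.
  by rewrite sum_nat_const -[X in (X * _)%N]cardsE cardS.
rewrite sum_nat_const card_ord; lia.
Qed.

Let rC : C := (r.+2)%:R.
Let sC : C := (s.+1)%:R.
Let delta : C := sqrtC (8 * rC ^+ 2 - 16 * rC + 9).

Lemma spectrum_multipartite :
  perm_eq (signless_laplacian_spectrum C X)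
    (nseq (r.+2 * s) (2 * sC * (rC - 1))
     ++ nseq (r.+1 * s.+1).-1 (rC * sC)
     ++ nseq r.+1 ((2 * rC - 3) * sC)
     ++ nseq 1 (sC * (4 * rC - 3 + delta) / 2)
     ++ nseq 1 (sC * (4 * rC - 3 - delta) / 2)).
Proof.
apply: prod_XsubC_eq; rewrite -char_poly_spectrum.
(* Evaluation points above the number of vertices avoid all denominators. *)
apply: (@poly_eq_large_nat _ _ _ #|vertex X|) => m ltm.
have pos (a : nat) : m%:R - #|vertex X|%:R + a%:R != 0 :> C.
  by rewrite -natrB 1?ltnW // -natrD pnatr_eq0; lia.
rewrite (signless_char_poly_multipartite adjE) //.
rewrite [\prod_i _]big_ord_recl [\sum_i _]big_ord_recl card0.
pose N : C := #|vertex X|%:R; pose z : C := m%:R.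
rewrite [X in _ * X * _](eq_bigr (fun=>
    (z - N + s.+1%:R) ^+ s.+1 * (z - N + (2 * s.+1)%:R) / (z - N + s.+1%:R)));
  last by move=> i _; rewrite cardS.
rewrite [X in 1 - (_ + X)](eq_bigr (fun=> s.+1%:R / (z - N + (2 * s.+1)%:R)));
  last by move=> i _; rewrite cardS.
rewrite prodr_const sumr_const card_ord.
rewrite !big_cat !big_nseq !iter_mulr_1 !expr1 !hornerM !horner_exp !hornerXsubC.
have d2 : delta ^+ 2 = 8 * rC ^+ 2 - 16 * rC + 9 by rewrite sqrtCK.
have eN : N = (2 * rC - 1) * sC by rewrite /N card_vertex_parts /rC /sC; ring.
have eu : z - N + s.+1%:R = z - 2 * sC * (rC - 1).
  by rewrite eN -/sC; ring.
have ev : z - N + (2 * s.+1)%:R = z - (2 * rC - 3) * sC.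
  by rewrite eN natrM -/sC; ring.
have ea : z - N + (r.+1 * s.+1)%:R = z - rC * sC.
  by rewrite eN natrM -/sC /rC; ring.
have eb : z - N + (2 * (r.+1 * s.+1))%:R = z - sC.
  by rewrite eN !natrM -/sC /rC; ring.
have := pos s.+1; have := pos (2 * s.+1)%N; have := pos (r.+1 * s.+1)%N.
have := pos (2 * (r.+1 * s.+1))%N.
rewrite -/N -/z eu ev ea eb => b0 a0 v0 u0.
have -> : (r.+1 * s.+1)%:R = (rC - 1) * sC by rewrite natrM /rC /sC; ring.
rewrite -/sC -[_ *+ r.+2]mulr_natl -/rC.
have -> : (r.+1 * s.+1 = (r.+1 * s.+1).-1.+1)%N by lia.
have cancel (x y : C) n : x != 0 -> x ^+ n.+1 * y / x = x ^+ n * y.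
  by move=> x0; rewrite exprS; field.
rewrite succnK !cancel //.
(* One of the [r.+2] factors [z - (2 * rC - 3) * sC] is split off to cancel a pole, which leaves the
   multiplicity [r.+1]. *)
rewrite exprMn -exprM [(s * _)%N]mulnC [(z - (2 * rC - 3) * sC) ^+ r.+2]exprS.
move: (_ ^+ (r.+2 * s)) (_ ^+ r.+1) (_ ^+ _.-1) => U V A.
have -> : (z - sC * (4 * rC - 3 + delta) / 2) * (z - sC * (4 * rC - 3 - delta) / 2)
  = z ^+ 2 - (4 * rC - 3) * sC * z + 2 * rC * (rC - 1) * sC ^+ 2.
  transitivity (z ^+ 2 - (4 * rC - 3) * sC * z
     + sC ^+ 2 * ((4 * rC - 3) ^+ 2 - delta ^+ 2) / 4); first by field.
  by rewrite d2; field.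
exact: quadratic_factor.
Qed.

(* Places the smaller of the two quadratic eigenvalues below the average degree 2|e|/|v|. *)
Lemma pred_le_delta : rC - 1 <= delta.
Proof.
have rE : rC = r%:R + 2 by rewrite /rC; ring.
have rm1 : 0 <= rC - 1 by rewrite (_ : _ - 1 = r.+1%:R) ?ler0n // /rC; ring.
rewrite -(sqrCK rm1) ler_sqrtC ?qualifE /= ?exprn_ge0 //; last first.
  rewrite (_ : _ + 9 = (8 * r ^ 2 + 16 * r + 9)%:R) ?ler0n // rE.
  by rewrite !natrD !natrM; ring.
rewrite -subr_ge0 (_ : _ - _ = (7 * r.+1 ^ 2 + 1)%:R) ?ler0n // rE.
by rewrite natrD natrM; ring.
Qed.

(** One absolute value survives: the eigenvalue [(2 * rC - 3) * sC] lies below the average degree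
    for r = 3 and above it for r >= 5. *)
Lemma energy_multipartite :
  signless_laplacian_energy C X
  = sC / (2 * rC - 1)
    * (rC * (sC - 1) * (rC - 1) * (rC - 2)
       + ((rC - 1) * sC - 1) * rC * (rC - 2)
       + (rC - 1) * `|rC ^+ 2 - 5 * rC + 3|)
    + sC * delta.
Proof.
rewrite /signless_laplacian_energy (perm_big _ spectrum_multipartite).
rewrite !big_cat !big_nseq !iter_addr_0 !mulr1n.
have x0 : 0 <= (r%:R : C) by rewrite ler0n.
have rE : rC = r%:R + 2 by rewrite /rC; ring.
have tr1 : 2 * rC - 1 = (2 * r + 3)%:R by rewrite rE natrD natrM; ring.
have tr1_neq0 : 2 * rC - 1 != 0 by rewrite tr1 pnatr_eq0; lia.
have tr1_ge0 : 0 <= 2 * rC - 1 by rewrite tr1 ler0n.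
have r2_ge0 : 0 <= rC - 2 by rewrite rE addrK.
have r1_ge0 : 0 <= rC - 1 by rewrite (_ : _ - 1 = r.+1%:R) ?ler0n // /rC; ring.
have sC0 : sC != 0 by rewrite pnatr_eq0.
(* In terms of q = s/(2r-1), the average degree and all deviations become polynomial multiples of
   q. *)
have [q [q0 qE qs]] : exists q : C,
    [/\ 0 <= q, sC / (2 * rC - 1) = q & sC = q * (2 * rC - 1)].
  by exists (sC / (2 * rC - 1)); rewrite divr_ge0 ?ler0n ?divfK.
have -> : (2 * #|edges X|)%:R / #|vertex X|%:R = 3 * rC * (rC - 1) * q.
  rewrite double_card_edges_parts card_vertex_parts.
  rewrite (_ : (_ * s.+1 ^ 2)%:R = 3 * (rC - 1) * rC * sC ^+ 2); last first.
    by rewrite !natrM /rC /sC; ring.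
  rewrite (_ : (_ * s.+1)%:R = (2 * rC - 1) * sC); last first.
    by rewrite natrM /rC /sC; ring.
  by rewrite expr2 mulrA -mulf_div divff // mulr1 -[_ * sC / _]mulrA qE; ring.
have e1 : `|2 * sC * (rC - 1) - 3 * rC * (rC - 1) * q| = q * (rC - 1) * (rC - 2).
  rewrite -[RHS]ger0_norm; first by congr `|_|; rewrite qs; ring.
  by rewrite !mulr_ge0.
have e2 : `|rC * sC - 3 * rC * (rC - 1) * q| = q * rC * (rC - 2).
  rewrite distrC -[RHS]ger0_norm; first by congr `|_|; rewrite qs; ring.
  by rewrite !mulr_ge0 ?ler0n.
have e3 : `|(2 * rC - 3) * sC - 3 * rC * (rC - 1) * q|
          = q * `|rC ^+ 2 - 5 * rC + 3|.
  rewrite -[q in RHS](ger0_norm q0) -normrM; congr `|_|.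
  by rewrite qs; ring.
have d0 := pred_le_delta.
have e4 : `|sC * (4 * rC - 3 + delta) / 2 - 3 * rC * (rC - 1) * q|
          = q * (2 * rC ^+ 2 - 4 * rC + 3 + (2 * rC - 1) * delta) / 2.
  rewrite -[RHS]ger0_norm; first by congr `|_|; rewrite qs; field.
  rewrite divr_ge0 ?ler0n // mulr_ge0 // addr_ge0 //.
    rewrite rE (_ : _ + 3 = (2 * r ^ 2 + 4 * r + 3)%:R) ?ler0n //.
    by rewrite !natrD !natrM; ring.
  by rewrite mulr_ge0 // (le_trans r1_ge0 d0).
have e5 : `|sC * (4 * rC - 3 - delta) / 2 - 3 * rC * (rC - 1) * q|
          = q * ((2 * rC - 1) * delta - (2 * rC ^+ 2 - 4 * rC + 3)) / 2.
  rewrite distrC -[RHS]ger0_norm; first by congr `|_|; rewrite qs; field.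
  rewrite divr_ge0 ?ler0n // mulr_ge0 // subr_ge0.
  (* Since [rC - 1 <= delta], it suffices that (2r-1)(r-1) - (2r^2-4r+3) = r-2 is nonnegative, where
     r is [rC]. *)
  apply: le_trans (ler_wpM2l tr1_ge0 d0).
  rewrite -subr_ge0 (_ : _ - _ = r%:R); first exact: x0.
  by rewrite rE; ring.
rewrite e1 e2 e3 e4 e5 -[_ *+ (r.+2 * s)]mulr_natl.
rewrite -[_ *+ _.-1]mulr_natl -[_ *+ r.+1]mulr_natl.
have -> : (r.+1 * s.+1).-1%:R = (rC - 1) * sC - 1.
  by rewrite -subn1 natrB // natrM /rC /sC; ring.
rewrite natrM (_ : s%:R = sC - 1); last by rewrite /sC; ring.
rewrite (_ : r.+1%:R = rC - 1); last by rewrite /rC; ring.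
by rewrite -/rC qE qs /=; field.
Qed.
End MultipartiteSpectrum.

(** * Normal form, commutation and center in the presented group *)

Section PresentedGroup.
Local Open Scope group_scope.

(* The dihedral extension of mathcomp's extremal groups is a concrete model of
   the presentation, up to replacing the second generator by its inverse. *)
Lemma leq_card_presentation (gT : finGroupType) (G : {group gT}) (r s : nat) :
  (1 < r)%N -> (0 < s)%N ->
  G \isog Grp (a : b : a ^+ r, b ^+ (2 * s), b * a * b^-1 = a^-1) ->
  (2 * r * s <= #|G|)%N.
Proof.
move=> r_gt1 s_gt0 isoG.
have p_gt1 : (1 < 2 * s)%N by lia.
have even_p : (2 %| 2 * s)%N by rewrite dvdn_mulr.
have cardE := card_ext_dihedral r_gt1 p_gt1 even_p.
have /existsP[[x y]] := isoGrp_hom (Grp_ext_dihedral r_gt1 p_gt1 even_p).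
set E := [set: _] in cardE * => /eqP[genE xr yp xy].
suffices /homgP[f fG] : E \homg G.
  by apply: leq_trans (leq_morphim f G); rewrite fG cardE; lia.
rewrite isoG; apply/existsP; exists (x, y^-1).
rewrite /= !xpair_eqE /= cycleV genE xr expgVn yp invg1 invgK.
by rewrite -mulgA -conjgE xy !eqxx.
Qed.

Variables (gT : finGroupType) (G : {group gT}) (r s : nat) (x y : gT).
Hypotheses (r_odd : odd r.+2) (genG : G :=: <[x]> <*> <[y]>).
Hypotheses (xr : x ^+ r.+2 = 1) (ys : y ^+ (2 * s.+1) = 1).
Hypotheses (yx : y * x * y^-1 = x^-1) (cardG : (2 * r.+2 * s.+1 <= #|G|)%N).

Local Notation index := ('I_r.+2 * 'I_s.+1 * bool)%type.

(** The exponent of [y] is split into a parity bit and an even part; the even power is central and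
    stands last so that it cancels from commutation questions. *)
Definition word (t : index) : gT := x ^+ t.1.1 * y ^+ t.2 * y ^+ (2 * t.1.2).

Lemma y_expx i : y * x ^+ i = x ^- i * y.
Proof.
have conjE z : y * z * y^-1 = z ^ y^-1 by rewrite conjgE invgK mulgA.
by apply: (mulIg y^-1); rewrite mulgK conjE conjXg -conjE yx expgVn.
Qed.

Lemma commute_y2_x k i : commute (y ^+ (2 * k)) (x ^+ i).
Proof.
rewrite expgM; apply/commute_sym/commuteX.
rewrite /commute expgS expg1 -[RHS]mulgA y_expx [RHS]mulgA.
have -> // : y * x ^- i = x ^+ i * y; last by rewrite mulgA.
by apply: (mulgI (x ^- i)); rewrite mulKg mulgA -y_expx mulgK.
Qed.

Lemma word_mem t : word t \in G.
Proof.
have xG : x \in G by rewrite genG mem_gen // inE cycle_id.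
have yG : y \in G by rewrite genG mem_gen // inE cycle_id orbT.
by rewrite !groupM ?groupX.
Qed.

Lemma word_onto g : g \in G -> exists t, g = word t.
Proof.
have nxy : <[y]> \subset 'N(<[x]>).
  rewrite cycle_subG -groupV inE -cycleJ cycle_subG conjgE invgK mulgA yx.
  by rewrite groupV cycle_id.
rewrite genG norm_joinEr // => /mulsgP[_ _ /cycleP[i ->] /cycleP[j ->] ->].
(* Writing j = 2 (j/2) + odd j, the half j/2 only matters modulo [s.+1] because
   [y ^+ (2 * s.+1) = 1]. *)
exists (inord (i %% r.+2), inord (j./2 %% s.+1), odd j).
rewrite /word /= !inordK ?ltn_pmod // -mulgA -expgD.
rewrite -[LHS](_ : x ^+ (i %% r.+2) * y ^+ j = _); last first.
  by rewrite {2}(divn_eq i r.+2) expgD mulnC expgM xr expg1n mul1g.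
congr (_ * _); rewrite -{1}[j]odd_double_half -mul2n.
rewrite {1}(divn_eq j./2 s.+1) mulnDr addnCA [LHS]expgD.
by rewrite [(_ %/ _ * _)%N]mulnC mulnA expgM ys expg1n mul1g.
Qed.

(** [word] maps an index set of 2rs elements onto [G], which has at least that many elements by
    [cardG]. *)
Lemma word_inj : injective word.
Proof.
have imG : word @: setT = G.
  apply/eqP; rewrite eqEsubset; apply/andP; split.
    by apply/subsetP=> _ /imsetP[t _ ->]; apply: word_mem.
  by apply/subsetP=> g /word_onto[t ->]; apply: imset_f.
suff /imset_injP inj : #|word @: setT| == #|[set: index]|.
  by move=> t u; apply: inj; rewrite inE.
rewrite eqn_leq leq_imset_card imG cardsT !card_prod !card_ord card_bool.
by apply: leq_trans cardG; lia.
Qed.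

Lemma expx_inj (i j : 'I_r.+2) : x ^+ i = x ^+ j -> i = j.
Proof.
move=> eq_ij; suff: (i, ord0 : 'I_s.+1, false) = (j, ord0, false) by case.
by apply: word_inj; rewrite /word /= eq_ij.
Qed.

(** Oddness of [r.+2] enters here: raising to the power [r.+3./2] undoes squaring on powers of
    [x]. *)
Lemma expx_double_inj (i j : 'I_r.+2) : x ^+ i * x ^+ i = x ^+ j * x ^+ j -> i = j.
Proof.
have sqr (k : nat) : (x ^+ k * x ^+ k) ^+ r.+3./2 = x ^+ k.
  rewrite -expgD addnn -expgM -mul2n mulnAC mulnC.
  have -> : (2 * r.+3./2 = r.+3)%N by move: r_odd; lia.
  by rewrite mulnS expgD mulnC expgM xr expg1n mulg1.
by move=> eq_ij; apply: expx_inj; rewrite -sqr eq_ij sqr.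
Qed.

Definition commuting (t u : index) :=
  match t.2, u.2 with
  | false, false => true
  | true, true => t.1.1 == u.1.1
  | false, true => t.1.1 == ord0
  | true, false => u.1.1 == ord0
  end.

Lemma commute_y2_word k t : commute (y ^+ (2 * k)) (word t).
Proof.
by apply/commuteM; first apply/commuteM; [exact: commute_y2_x| |];
   apply/commuteX2.
Qed.

(** Once central factors cancel, two words with an odd power of [y] commute iff x^(i-j) = x^(j-i),
    and a mixed pair iff the purely rotational power equals its inverse. Injectivity of doubling
    turns these into i = j and exponent 0. *)
Lemma commute_wordE t u : (word t * word u == word u * word t) = commuting t u.
Proof.
pose h (t : index) := x ^+ t.1.1 * y ^+ t.2.
have wordM v w : word v * word w = h v * h w * y ^+ (2 * (v.1.2 + w.1.2)).
  rewrite {1}/word -/(h v) -mulgA commute_y2_word /word -/(h w) -!mulgA.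
  by rewrite -expgD -mulnDr addnC.
rewrite !wordM addnC (inj_eq (mulIg _)).
have xx i j : x ^+ i * x ^+ j = x ^+ j * x ^+ i by rewrite -!expgD addnC.
have xV (j : 'I_r.+2) : (x ^- j == x ^+ j) = (j == ord0).
  rewrite eq_sym eq_mulgV1 invgK; apply/eqP/eqP=> [xjj|->]; last exact: mulg1.
  by apply: expx_double_inj; rewrite xjj mulg1.
have xyx i j : x ^+ i * y * x ^+ j = x ^+ i * x ^- j * y.
  by rewrite -mulgA y_expx mulgA.
rewrite /h /commuting; case: t u {h wordM} => [[i k] [|]] [[j l] [|]] /=;
  rewrite ?mulg1 ?expg1 ?mulgA ?xyx ?(inj_eq (mulIg _)).
- apply/eqP/eqP=> [eq_ij|->//]; apply: expx_double_inj.
  apply: (mulgI (x ^- j)); rewrite mulKg -[RHS]mulg1 -(mulVg (x ^+ i)).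
  by rewrite [in RHS]mulgA -eq_ij (commuteV (xx i j)) mulgA.
- by rewrite xx (inj_eq (mulgI _)) xV.
- by rewrite xx (inj_eq (mulgI _)) eq_sym xV.
- by rewrite xx eqxx.
Qed.

Lemma center_wordE t : (word t \in 'Z(G)) = ~~ t.2 && (t.1.1 == ord0).
Proof.
apply/centerP/idP => [[_ cGt]|/andP[]].
  have cG u : commuting t u by rewrite -commute_wordE cGt ?word_mem.
  (* The test elements are the generators: [x] excludes a true bit, then [y] forces the exponent of
     [x] to be 0. *)
  have := cG (inord 1, ord0, false); have := cG (ord0, ord0, true).
  by rewrite /commuting; case: t.2 => //= _; rewrite -val_eqE /= inordK.
case: t => [[i k] []] //= _ /eqP->; split=> [|_ /word_onto[u ->]]; first exact: word_mem.
by apply/eqP; rewrite commute_wordE /commuting /=; case: u.2.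
Qed.

Lemma noncommuting_multipartite :
  exists c : vertex (noncommuting_graph G) -> 'I_r.+3,
  [/\ forall u v, adj u v = (c u != c v),
      #|[set u | c u == ord0]| = (r.+1 * s.+1)%N
    & forall i, #|[set u | c u == lift ord0 i]| = s.+1].
Proof.
have wordP (v : vertex (noncommuting_graph G)) : {t | val v == word t}.
  by apply: sigW; have /setDP[/word_onto[t ->]] := valP v; exists t.
pose t v := sval (wordP v).
have tE v : val v = word (t v) by apply: (eqP (svalP (wordP v))).
(* Label [ord0] collects the words with false bit; a true bit gives one part per exponent of [x]. *)
pose l (u : index) := if u.2 then lift ord0 u.1.1 else ord0.
have nZ v : ~~ ((~~ (t v).2) && ((t v).1.1 == ord0)).
  by rewrite -center_wordE -tE; case: v => v /= /setDP[].
have t_inj : injective t by move=> u v tuv; apply: val_inj; rewrite !tE tuv.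
have cardE i : #|[set v | l (t v) == i]|
   = #|[set u | ~~ (~~ u.2 && (u.1.1 == ord0)) & l u == i]|.
  rewrite -(card_imset _ t_inj); congr #|pred_of_set _|; apply/setP=> u.
  rewrite !inE; apply/imsetP/andP=> [[v + ->]|[nzu lu]]; first by rewrite inE nZ.
  have uG : word u \in G :\: 'Z(G) by rewrite inE center_wordE nzu word_mem.
  pose v : vertex (noncommuting_graph G) := Sub (word u) uG.
  have tv : t v = u by apply: word_inj; rewrite -tE.
  by exists v; rewrite ?inE tv.
exists (l \o t); split=> [u v||i] /=.
- rewrite /= /nc_adj !tE commute_wordE; congr (~~ _).
  (* Noncentrality excludes exponent 0 when the bit is false, so mixed pairs never commute and
     commuting is equality of labels. *)
  rewrite /l /commuting; have := nZ u; have := nZ v.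
  case: (t u).2 (t v).2 => [] [] //= nv nu; rewrite ?(inj_eq (@lift_inj _ _)) //.
  + by rewrite (negbTE nv).
  + by rewrite (negbTE nu).
- rewrite cardE [X in #|pred_of_set X|](_ : _ = setX (setX [set~ ord0] setT) [set false]).
    by rewrite !cardsX cardsC1 cardsT !card_ord cards1 muln1.
  by apply/setP=> [[[i k] []]]; rewrite !inE /l /= ?andbT ?andbF.
- rewrite cardE [X in #|pred_of_set X|](_ : _ = setX (setX [set i] setT) [set true]).
    by rewrite !cardsX cardsT !card_ord !cards1 muln1 mul1n.
  by apply/setP=> [[[j k] []]]; rewrite !inE /l /= ?(inj_eq (@lift_inj _ _)) ?andbT ?andbF.
Qed.
End PresentedGroup.

(** * Spectrum and the two energy cases for the presented group *)

Theorem theorem2p9 (C : numClosedFieldType) (gT : finGroupType) (G : {group gT})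
    (r s : nat) (hr : (3 <= r)%N) (hodd : odd r) (hs : (1 <= s)%N)
    (hG : (G \isog Grp (a : b : a ^+ r, b ^+ (2 * s),
                                b * a * b^-1 = a^-1))%g) :
  let rC : C := r%:R in
  let sC : C := s%:R in
  let delta : C := sqrtC (8 * rC ^+ 2 - 16 * rC + 9) in
  perm_eq (signless_laplacian_spectrum C (noncommuting_graph G))
    (nseq (r * (s - 1)) (2 * sC * (rC - 1))
     ++ nseq ((r - 1) * s - 1) (rC * sC)
     ++ nseq (r - 1) ((2 * rC - 3) * sC)
     ++ nseq 1 (sC * (4 * rC - 3 + delta) / 2)
     ++ nseq 1 (sC * (4 * rC - 3 - delta) / 2))
  /\ (r = 3%N ->
      signless_laplacian_energy C (noncommuting_graph G)
      = 3 * sC * (4 * sC - 1) / 5 + sC * sqrtC 33)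
  /\ ((5 <= r)%N ->
      signless_laplacian_energy C (noncommuting_graph G)
      = sC * (2 * rC * (rC - 1) * (rC - 2) * sC / (2 * rC - 1)
              - (2 * rC - 3) + delta)).
Proof.
case: r hr hodd hG => [|[|r]] // r_ge hodd hG; case: s hs hG => // s _ hG.
have cardG := leq_card_presentation (ltnW r_ge) (ltn0Sn s) hG.
have [x [y [genG xr ys yx]]] : exists x y,
    [/\ <[x]> <*> <[y]> = G, x ^+ r.+2 = 1, y ^+ (2 * s.+1) = 1
      & y * x * y^-1 = x^-1]%g.
  have /existsP[[x y] /eqP[genG xr ys yx]] := isoGrp_hom hG.
  by exists x, y.
have [c [adjE c0 cS]] := noncommuting_multipartite hodd (esym genG) xr ys yx cardG.
move=> rC sC delta; split.
  rewrite !subn1 !succnK; exact: spectrum_multipartite adjE c0 cS.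
have -> := energy_multipartite C adjE c0 cS.
rewrite -/rC -/sC -/delta; split=> [r1 | r_ge5].
  have rE : rC = 3 by rewrite /rC r1.
  have -> : delta = sqrtC 33 by rewrite /delta rE; congr sqrtC; ring.
  have -> : `|rC ^+ 2 - 5 * rC + 3| = 3.
    by rewrite -[RHS]normr_nat -normrN rE; congr `|_|; ring.
  by rewrite rE; field.
(* [r] is now the theorem's r minus 2. With m = [r - 3], the expression under the absolute value
   becomes m^2 + 5m + 3, visibly nonnegative. *)
have rE : rC = (r - 3)%:R + 5 by rewrite natrB //; rewrite /rC; ring.
rewrite ger0_norm; last first.
  rewrite (_ : _ + 3 = (r - 3)%:R ^+ 2 + 5 * (r - 3)%:R + 3); last by rewrite rE; ring.
  by rewrite !addr_ge0 ?mulr_ge0 ?exprn_ge0 ?ler0n.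
have r0 : 2 * rC - 1 != 0.
  by rewrite (_ : _ - 1 = (2 * r + 3)%:R) ?pnatr_eq0 ?addn_eq0 ?andbF // /rC natrD natrM; ring.
move: (rC) r0 (sC) (delta) => t t0 u d; field; exact: t0.
Qed.
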